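(* Let $n\ge 1$ be an integer, let $\mathscr{M}$ be an $n$-cluster tilting subcategory of an abelian category $\mathscr{A}$, and let $\mathscr{X}\subseteq\mathscr{M}$ be an $n$-cotorsion class. Then the following hold. (i) $\mathscr{X}$ is closed under direct summands and finite direct sums. (ii) $\mathscr{X}$ contains all projective objects of $\mathscr{M}$. (iii) If $\mathscr{X}$ is closed under $n$-syzygies, then for every sequence $r_n\to\cdots\to r_1$ in $\mathscr{X}\text{-}\mathrm{exact}_n$, every $x\in\mathscr{X}$ and every integer $i\ge 1$, the induced sequence of abelian groups $$0\to \mathrm{Ext}^{ni}_{\mathscr{A}}(x,r_n)\to\cdots\to \mathrm{Ext}^{ni}_{\mathscr{A}}(x,r_1)\to 0$$ is exact.
   Context: $\mathrm{Ext}$ groups in $\mathscr{A}$ are Yoneda Ext groups. An additive full subcategory $\mathscr{M}$ of an abelian category $\mathscr{A}$ is called $n$-cluster tilting if: it is functorially finite in $\mathscr{A}$ (every object of $\mathscr{A}$ has a right and a left $\mathscr{M}$-approximation); it is generating and cogenerating (for every $a\in\mathscr{A}$ there are an epimorphism $m\to a$ and a monomorphism $a\to m'$ with $m,m'\in\mathscr{M}$); and $$\mathscr{M}=\{a\in\mathscr{A}\mid \mathrm{Ext}^i_{\mathscr{A}}(\mathscr{M},a)=0,\ 0<i<n\}=\{a\in\mathscr{A}\mid \mathrm{Ext}^i_{\mathscr{A}}(a,\mathscr{M})=0,\ 0<i<n\}.$$ For a full subcategory $\mathscr{X}\subseteq\mathscr{M}$, $\mathscr{X}\text{-}\mathrm{exact}_n$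 denotes the class of all sequences of morphisms $m_n\to m_{n-1}\to\cdots\to m_1$ in $\mathscr{M}$ such that for all $x\in\mathscr{X}$ the induced sequence $0\to\mathrm{Ext}^n_{\mathscr{A}}(x,m_n)\to\mathrm{Ext}^n_{\mathscr{A}}(x,m_{n-1})\to\cdots\to\mathrm{Ext}^n_{\mathscr{A}}(x,m_1)\to 0$ of abelian groups is exact. ${}^{\perp}(\mathscr{X}\text{-}\mathrm{exact}_n)$ denotes the full subcategory of $\mathscr{M}$ of all $m\in\mathscr{M}$ such that for every sequence $m_n\to\cdots\to m_1$ in $\mathscr{X}\text{-}\mathrm{exact}_n$ the induced sequence $0\to\mathrm{Ext}^n_{\mathscr{A}}(m,m_n)\to\cdots\to\mathrm{Ext}^n_{\mathscr{A}}(m,m_1)\to 0$ is exact. $\mathscr{X}$ is an $n$-cotorsion class if $\mathscr{X}={}^{\perp}(\mathscr{X}\text{-}\mathrm{exact}_n)$. An object $p\in\mathscr{M}$ is projective if for every epimorphism $a\to b$ in $\mathscr{M}$ the map $\mathscr{M}(p,a)\to\mathscr{M}(p,b)$ is surjective, where $\mathscr{M}(-,-)$ denotes Hom in $\mathscr{M}$. An $n$-exact sequence in $\mathscr{M}$ is an exact sequence $0\to m_{n+1}\to m_n\to\cdots\to m_1\to m_0\to 0$ in $\mathscr{A}$ with all terms in $\mathscr{M}$. If there is an $n$-exact sequence $0\to k\to p_n\to\cdots\to p_1\to m\to 0$ in $\mathscr{M}$ with all $p_i$ projective, then $k$ is called an $n$-syzygy of $m$. $\mathscr{X}$ is closed under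 $n$-syzygies if every $x\in\mathscr{X}$ has an $n$-syzygy $k$ with $k\in\mathscr{X}$. *)

(* Defs.v *)
From HB Require Import structures.
From Stdlib Require Import Relations.
From mathcomp Require Import all_boot all_algebra.
From mathcomp Require Import generic_quotient boolp.

Set Implicit Arguments.
Unset Strict Implicit.
Unset Printing Implicit Defensive.

Import GRing.Theory.
Local Open Scope ring_scope.

Record preadditive := Preadditive {
  obj :> Type;
  Hom : obj -> obj -> zmodType;
  idm : forall a, Hom a a;
  mcomp : forall a b c, Hom b c -> Hom a b -> Hom a c;
  compA : forall a b c d (h : Hom c d) (g : Hom b c) (f : Hom a b),
    mcomp h (mcomp g f) = mcomp (mcomp h g) f;
  comp1m : forall a b (f : Hom a b), mcomp (idm b) f = f;
  compm1 : forall a b (f : Hom a b), mcomp f (idm a) = f;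
  compDl : forall a b c (g h : Hom b c) (f : Hom a b),
    mcomp (g + h) f = mcomp g f + mcomp h f;
  compDr : forall a b c (g : Hom b c) (f h : Hom a b),
    mcomp g (f + h) = mcomp g f + mcomp g h
}.
Arguments Hom {p} _ _.
Arguments idm {p} a.
Arguments mcomp {p a b c} g f.

Notation "g ∘ f" := (mcomp g f) (at level 40, left associativity).

Section Preadditive.
Variable A : preadditive.
Implicit Types a b c : A.

Definition mono a b (f : Hom a b) :=
  forall c (g h : Hom c a), f ∘ g = f ∘ h -> g = h.

Definition epi a b (f : Hom a b) :=
  forall c (g h : Hom b c), g ∘ f = h ∘ f -> g = h.

Definition is_kernel a b c (k : Hom a b) (f : Hom b c) :=
  f ∘ k = 0 /\
  forall x (h : Hom x b), f ∘ h = 0 -> exists! u : Hom x a, k ∘ u = h.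

Definition is_cokernel a b c (q : Hom b c) (f : Hom a b) :=
  q ∘ f = 0 /\
  forall x (h : Hom b x), h ∘ f = 0 -> exists! u : Hom c x, u ∘ q = h.

(* [s] is a direct sum (biproduct) of the family [x]; for empty [I] this says *)
(* that [s] is a zero object                                                  *)
Definition is_dirsum (I : finType) (x : I -> A) (s : A) :=
  exists (inj : forall i, Hom (x i) s) (prj : forall i, Hom s (x i)),
  [/\ forall i, prj i ∘ inj i = idm (x i),
      forall i j, i != j -> prj j ∘ inj i = 0
    & \sum_i inj i ∘ prj i = idm s].

Definition direct_summand (y x : A) :=
  exists z : A, is_dirsum (fun b : bool => if b then y else z) x.

Lemma comp0m a b c (f : Hom a b) : (0 : Hom b c) ∘ f = 0.
Proof. by apply: (addIr (0 ∘ f)); rewrite -compDl !add0r. Qed.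

Lemma compm0 a b c (g : Hom b c) : g ∘ (0 : Hom a b) = 0.
Proof. by apply: (addIr (g ∘ 0)); rewrite -compDr !add0r. Qed.

Lemma compNm a b c (g : Hom b c) (f : Hom a b) : (- g) ∘ f = - (g ∘ f).
Proof. by apply: (addIr (g ∘ f)); rewrite -compDl !addNr comp0m. Qed.

Lemma compmN a b c (g : Hom b c) (f : Hom a b) : g ∘ (- f) = - (g ∘ f).
Proof. by apply: (addIr (g ∘ f)); rewrite -compDr !addNr compm0. Qed.

Lemma kernel_mono a b c (k : Hom a b) (f : Hom b c) : is_kernel k f -> mono k.
Proof.
move=> [fk kU] x g h e.
have [|u [_ uU]] := kU _ (k ∘ h); first by rewrite compA fk comp0m.
by rewrite -(uU g e) -(uU h erefl).
Qed.

Lemma cokernel_epi a b c (q : Hom b c) (f : Hom a b) : is_cokernel q f -> epi q.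
Proof.
move=> [qf qU] x g h e.
have [|u [_ uU]] := qU _ (h ∘ q); first by rewrite -compA qf compm0.
by rewrite -(uU g e) -(uU h erefl).
Qed.

Lemma mono_eq0 a b (f : Hom a b) :
  (forall c (g : Hom c a), f ∘ g = 0 -> g = 0) -> mono f.
Proof.
move=> f0 c g h e; apply/eqP; rewrite -subr_eq0; apply/eqP/f0.
by rewrite compDr compmN e subrr.
Qed.

Lemma epi_eq0 a b (f : Hom a b) :
  (forall c (g : Hom b c), g ∘ f = 0 -> g = 0) -> epi f.
Proof.
move=> f0 c g h e; apply/eqP; rewrite -subr_eq0; apply/eqP/f0.
by rewrite compDl compNm e subrr.
Qed.

Lemma is_kernelP a b c (k : Hom a b) (f : Hom b c) :
  mono k -> f ∘ k = 0 ->
  (forall x (h : Hom x b), f ∘ h = 0 -> exists u : Hom x a, k ∘ u = h) ->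
  is_kernel k f.
Proof.
move=> km fk kU; split=> // x h /kU[u ku]; exists u; split=> // v kv.
by apply: km; rewrite ku kv.
Qed.

Lemma is_cokernelP a b c (q : Hom b c) (f : Hom a b) :
  epi q -> q ∘ f = 0 ->
  (forall x (h : Hom b x), h ∘ f = 0 -> exists u : Hom c x, u ∘ q = h) ->
  is_cokernel q f.
Proof.
move=> qe qf qU; split=> // x h /qU[u uq]; exists u; split=> // v vq.
by apply: qe; rewrite uq vq.
Qed.

Lemma kernel_of_coker a b c d (f : Hom a b) (q : Hom b c) (g : Hom b d) :
  is_kernel f g -> is_cokernel q f -> is_kernel f q.
Proof.
move=> fg [qf qU]; have [gf fU] := fg.
apply: is_kernelP => //; first exact: kernel_mono fg.
move=> x h qh; have [g' [gq _]] := qU _ _ gf.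
have [|u [fu _]] := fU _ h; last by exists u.
by rewrite -gq -compA qh compm0.
Qed.

Lemma coker_of_kernel a b c d (f : Hom b a) (k : Hom c b) (g : Hom d b) :
  is_cokernel f g -> is_kernel k f -> is_cokernel f k.
Proof.
move=> fg [fk kU]; have [fg0 fU] := fg.
apply: is_cokernelP => //; first exact: cokernel_epi fg.
move=> x h hk; have [g' [kg _]] := kU _ _ fg0.
have [|u [uf _]] := fU _ h; last by exists u.
by rewrite -kg compA hk comp0m.
Qed.

End Preadditive.

Record abelian := Abelian {
  cat :> preadditive;
  zeroob : cat;
  idm_zeroob : idm zeroob = 0;
  bip : cat -> cat -> cat;
  in1 : forall a b, Hom a (bip a b);
  in2 : forall a b, Hom b (bip a b);
  pr1 : forall a b, Hom (bip a b) a;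
  pr2 : forall a b, Hom (bip a b) b;
  pr1in1 : forall a b, pr1 a b ∘ in1 a b = idm a;
  pr1in2 : forall a b, pr1 a b ∘ in2 a b = 0;
  pr2in1 : forall a b, pr2 a b ∘ in1 a b = 0;
  pr2in2 : forall a b, pr2 a b ∘ in2 a b = idm b;
  bip_idm : forall a b,
    in1 a b ∘ pr1 a b + in2 a b ∘ pr2 a b = idm (bip a b);
  kerob : forall (a b : cat), Hom a b -> cat;
  ker : forall (a b : cat) (f : Hom a b), Hom (kerob f) a;
  kerP : forall (a b : cat) (f : Hom a b), is_kernel (ker f) f;
  cokerob : forall (a b : cat), Hom a b -> cat;
  coker : forall (a b : cat) (f : Hom a b), Hom b (cokerob f);
  cokerP : forall (a b : cat) (f : Hom a b), is_cokernel (coker f) f;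
  mono_normal : forall (a b : cat) (f : Hom a b), mono f ->
    exists (c : cat) (g : Hom b c), is_kernel f g;
  epi_normal : forall (a b : cat) (f : Hom a b), epi f ->
    exists (c : cat) (g : Hom c a), is_cokernel f g
}.
Arguments in1 {a0 a b} : rename.
Arguments in2 {a0 a b} : rename.
Arguments pr1 {a0 a b} : rename.
Arguments pr2 {a0 a b} : rename.

Section Biproduct.
Variable A : abelian.
Implicit Types a b c x y : A.

(* pairing, copairing and direct sum of morphisms *)
Definition pairm x a b (f : Hom x a) (g : Hom x b) : Hom x (bip a b) :=
  in1 ∘ f + in2 ∘ g.
Definition copairm x a b (f : Hom a x) (g : Hom b x) : Hom (bip a b) x :=
  f ∘ pr1 + g ∘ pr2.
Definition bipm a b c x (f : Hom a c) (g : Hom b x) : Hom (bip a b) (bip c x) :=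
  pairm (f ∘ pr1) (g ∘ pr2).

Lemma pr1_pairm x a b (f : Hom x a) (g : Hom x b) : pr1 ∘ pairm f g = f.
Proof. by rewrite compDr !compA pr1in1 pr1in2 comp1m comp0m addr0. Qed.
Lemma pr2_pairm x a b (f : Hom x a) (g : Hom x b) : pr2 ∘ pairm f g = g.
Proof. by rewrite compDr !compA pr2in1 pr2in2 comp1m comp0m add0r. Qed.
Lemma copairm_in1 x a b (f : Hom a x) (g : Hom b x) : copairm f g ∘ in1 = f.
Proof. by rewrite compDl -!compA pr1in1 pr2in1 compm1 compm0 addr0. Qed.
Lemma copairm_in2 x a b (f : Hom a x) (g : Hom b x) : copairm f g ∘ in2 = g.
Proof. by rewrite compDl -!compA pr1in2 pr2in2 compm1 compm0 add0r. Qed.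

Lemma bip_homl x a b (f g : Hom x (bip a b)) :
  pr1 ∘ f = pr1 ∘ g -> pr2 ∘ f = pr2 ∘ g -> f = g.
Proof.
move=> e1 e2; rewrite -[f]comp1m -[g]comp1m -bip_idm !compDl -!compA.
by rewrite e1 e2.
Qed.

Lemma bip_homr x a b (f g : Hom (bip a b) x) :
  f ∘ in1 = g ∘ in1 -> f ∘ in2 = g ∘ in2 -> f = g.
Proof.
move=> e1 e2; rewrite -[f]compm1 -[g]compm1 -bip_idm !compDr !compA.
by rewrite e1 e2.
Qed.

Lemma pr1_bipm a b c x (f : Hom a c) (g : Hom b x) :
  pr1 ∘ bipm f g = f ∘ pr1.
Proof. exact: pr1_pairm. Qed.
Lemma pr2_bipm a b c x (f : Hom a c) (g : Hom b x) :
  pr2 ∘ bipm f g = g ∘ pr2.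
Proof. exact: pr2_pairm. Qed.

Lemma pairm_comp y x a b (f : Hom x a) (g : Hom x b) (h : Hom y x) :
  pairm f g ∘ h = pairm (f ∘ h) (g ∘ h).
Proof. by apply: bip_homl; rewrite compA ?pr1_pairm ?pr2_pairm. Qed.

Lemma bipm_pairm x a b c d (f : Hom a c) (g : Hom b d)
    (h : Hom x a) (k : Hom x b) :
  bipm f g ∘ pairm h k = pairm (f ∘ h) (g ∘ k).
Proof.
by rewrite pairm_comp -!compA pr1_pairm pr2_pairm.
Qed.

Lemma bipm_comp a b c d x y (f : Hom a c) (g : Hom b d)
    (h : Hom x a) (k : Hom y b) :
  bipm f g ∘ bipm h k = bipm (f ∘ h) (g ∘ k).
Proof. by rewrite bipm_pairm !compA. Qed.

Lemma bipm1 a b : bipm (idm a) (idm b) = idm (bip a b).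
Proof.
by apply: bip_homl; rewrite ?pr1_bipm ?pr2_bipm comp1m compm1.
Qed.

Lemma copairm_bipm a b c d x (f : Hom c x) (g : Hom d x)
    (h : Hom a c) (k : Hom b d) :
  copairm f g ∘ bipm h k = copairm (f ∘ h) (g ∘ k).
Proof. by rewrite compDl -!compA pr1_bipm pr2_bipm !compA. Qed.

Lemma copairm_comp a b x y (f : Hom a x) (g : Hom b x) (h : Hom x y) :
  h ∘ copairm f g = copairm (h ∘ f) (h ∘ g).
Proof. by rewrite compDr !compA. Qed.

Lemma copairm_pairm a b x y (f : Hom a x) (g : Hom b x)
    (h : Hom y a) (k : Hom y b) :
  copairm f g ∘ pairm h k = f ∘ h + g ∘ k.
Proof. by rewrite compDl -!compA pr1_pairm pr2_pairm. Qed.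

Lemma hom0l a (f : Hom (zeroob A) a) : f = 0.
Proof. by rewrite -[f]compm1 idm_zeroob compm0. Qed.
Lemma hom0r a (f : Hom a (zeroob A)) : f = 0.
Proof. by rewrite -[f]comp1m idm_zeroob comp0m. Qed.

Definition diag a : Hom a (bip a a) := pairm (idm a) (idm a).
Definition codiag a : Hom (bip a a) a := copairm (idm a) (idm a).

End Biproduct.

Section Exact.
Variable A : abelian.
Implicit Types a b c x : A.

Definition im a b (f : Hom a b) := ker (coker f).

Definition exact_at a b c (f : Hom a b) (g : Hom b c) := is_kernel (im f) g.

(* 0 -> b -> se_mid -> a -> 0 *)
Record ses a b := Ses {
  se_mid : A;
  se_i : Hom b se_mid;
  se_p : Hom se_mid a;
  se_ker : is_kernel se_i se_p;
  se_coker : is_cokernel se_p se_i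
}.


(* there is a morphism of short exact sequences S -> T which is al on the     *)
(* right ends and be on the left ends                                         *)
Definition ses_mor a b a' b' (al : Hom a a') (be : Hom b b')
    (S : ses a b) (T : ses a' b') :=
  exists f : Hom (se_mid S) (se_mid T),
    f ∘ se_i S = se_i T ∘ be /\ se_p T ∘ f = al ∘ se_p S.

Lemma ses_mor_id a b (S : ses a b) : ses_mor (idm a) (idm b) S S.
Proof. by exists (idm _); rewrite !comp1m !compm1. Qed.

Lemma ses_mor_comp a b a' b' a'' b'' (al : Hom a a') (be : Hom b b')
    (al' : Hom a' a'') (be' : Hom b' b'')
    (S : ses a b) (T : ses a' b') (U : ses a'' b'') :
  ses_mor al be S T -> ses_mor al' be' T U ->
  ses_mor (al' ∘ al) (be' ∘ be) S U.
Proof.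
move=> [f [fi pf]] [g [gi pg]]; exists (g ∘ f); split.
  by rewrite -compA fi compA gi compA.
by rewrite compA pg -compA pf compA.
Qed.

Lemma mono_kernel a b c (f : Hom a b) (q : Hom b c) :
  mono f -> is_cokernel q f -> is_kernel f q.
Proof. by move=> /mono_normal[d [g fg]]; apply: kernel_of_coker fg. Qed.

Lemma epi_cokernel a b c (f : Hom b a) (k : Hom c b) :
  epi f -> is_kernel k f -> is_cokernel f k.
Proof. by move=> /epi_normal[d [g fg]]; apply: coker_of_kernel fg. Qed.

Lemma push_ex a b b' (f : Hom b b') (S : ses a b) :
  exists S' : ses a b', ses_mor (idm a) f S S' /\
  forall x y (T : ses x y) (al : Hom a x) (be : Hom b' y),
    ses_mor al (be ∘ f) S T -> ses_mor al be S' T.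
Proof.
have [pi0 _] := se_ker S.
pose u : Hom b (bip (se_mid S) b') := pairm (se_i S) (- f).
pose q := coker u; have [qu U] := cokerP u; rewrite -/q in qu U.
pose i' : Hom b' (cokerob u) := q ∘ in2.
pose j : Hom (se_mid S) (cokerob u) := q ∘ in1.
have ji : j ∘ se_i S = i' ∘ f.
  move/eqP: qu; rewrite compDr compmN compmN !compA subr_eq0.
  by move/eqP.
have qU x (g : Hom (se_mid S) x) (h : Hom b' x) : g ∘ se_i S = h ∘ f ->
    exists k : Hom (cokerob u) x, k ∘ j = g /\ k ∘ i' = h.
  move=> e; have [|k [kq _]] := U _ (copairm g h).
    by rewrite copairm_pairm compmN e subrr.
  by exists k; rewrite !compA kq copairm_in1 copairm_in2.
have qE x (k h : Hom (cokerob u) x) :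
    k ∘ j = h ∘ j -> k ∘ i' = h ∘ i' -> k = h.
  move=> e1 e2; apply: (cokernel_epi (cokerP u)).
  by apply: bip_homr; rewrite -!compA.
have [|p' [p'j p'i]] := qU _ (se_p S) 0; first by rewrite comp0m.
have p'c : is_cokernel p' i'.
  apply: is_cokernelP => //.
    apply: epi_eq0 => c g gp; apply: (cokernel_epi (se_coker S)).
    by rewrite -p'j compA gp !comp0m.
  move=> x g gi; have [_ V] := se_coker S.
  have [|k [kp _]] := V _ (g ∘ j); first by rewrite -compA ji compA gi comp0m.
  exists k; apply: qE; first by rewrite -compA p'j kp.
  by rewrite -compA p'i compm0 gi.
have um : mono u.
  apply: mono_eq0 => c g ug; apply: (kernel_mono (se_ker S)).
  by rewrite compm0 -[LHS](pr1_pairm _ (- f ∘ g)) -pairm_comp ug compm0.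
have i'm : mono i'.
  apply: mono_eq0 => c g ig.
  have [_ V] := mono_kernel um (cokerP u).
  have [|v [uv _]] := V _ (in2 ∘ g); first by rewrite compA.
  have v0 : v = 0.
    apply: (kernel_mono (se_ker S)); rewrite compm0.
    rewrite -[se_i S](pr1_pairm _ (- f)) -/u -compA uv compA pr1in2.
    by rewrite comp0m.
  by rewrite -[g]comp1m -(pr2in2 (se_mid S) b') -compA -uv v0 !compm0.
exists (Ses (mono_kernel i'm p'c) p'c); split.
  by exists j; split; rewrite /= ?comp1m.
move=> x y T al be [g /= [gi pg]].
have [|k [kj ki]] := qU _ g (se_i T ∘ be); first by rewrite gi compA.
exists k; split=> //=; apply: qE.
  by rewrite -!compA kj pg p'j.
have [pi1 _] := se_ker T.
by rewrite -!compA ki p'i compm0 compA pi1 comp0m.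
Qed.

Lemma pull_ex a a' b (f : Hom a' a) (S : ses a b) :
  exists S' : ses a' b, ses_mor f (idm b) S' S /\
  forall x y (T : ses x y) (al : Hom x a') (be : Hom y b),
    ses_mor (f ∘ al) be T S -> ses_mor al be T S'.
Proof.
have [pi0 _] := se_coker S.
pose u : Hom (bip (se_mid S) a') a := copairm (se_p S) (- f).
pose q := ker u; have [qu U] := kerP u; rewrite -/q in qu U.
pose p' : Hom (kerob u) a' := pr2 ∘ q.
pose j : Hom (kerob u) (se_mid S) := pr1 ∘ q.
have pj : se_p S ∘ j = f ∘ p'.
  move/eqP: qu; rewrite compDl compNm compNm -!compA subr_eq0.
  by move/eqP.
have qU x (g : Hom x (se_mid S)) (h : Hom x a') : se_p S ∘ g = f ∘ h ->
    exists k : Hom x (kerob u), j ∘ k = g /\ p' ∘ k = h.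
  move=> e; have [|k [kq _]] := U _ (pairm g h).
    by rewrite copairm_pairm compNm e subrr.
  by exists k; rewrite -!compA kq pr1_pairm pr2_pairm.
have qE x (k h : Hom x (kerob u)) :
    j ∘ k = j ∘ h -> p' ∘ k = p' ∘ h -> k = h.
  move=> e1 e2; apply: (kernel_mono (kerP u)).
  by apply: bip_homl; rewrite !compA.
have [|i' [ji p'i]] := qU _ (se_i S) 0; first by rewrite compm0.
have i'k : is_kernel i' p'.
  apply: is_kernelP => //.
    apply: mono_eq0 => c g gp; apply: (kernel_mono (se_ker S)).
    by rewrite -ji -compA gp !compm0.
  move=> x g gi; have [_ V] := se_ker S.
  have [|k [kp _]] := V _ (j ∘ g); first by rewrite compA pj -compA gi compm0.
  exists k; apply: qE; first by rewrite compA ji kp.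
  by rewrite compA p'i comp0m gi.
have ue : epi u.
  apply: epi_eq0 => c g ug; apply: (cokernel_epi (se_coker S)).
  by rewrite comp0m -[LHS](copairm_in1 _ (g ∘ - f)) -copairm_comp ug comp0m.
have p'e : epi p'.
  apply: epi_eq0 => c g ig.
  have [_ V] := epi_cokernel ue (kerP u).
  have [|v [uv _]] := V _ (g ∘ pr2); first by rewrite -compA.
  have v0 : v = 0.
    apply: (cokernel_epi (se_coker S)); rewrite comp0m.
    rewrite -[se_p S](copairm_in1 _ (- f)) -/u compA uv -compA pr2in1.
    by rewrite compm0.
  by rewrite -[g]compm1 -(pr2in2 (se_mid S) a') compA -uv v0 !comp0m.
exists (Ses i'k (epi_cokernel p'e i'k)); split.
  by exists j; split; rewrite /= ?compm1.
move=> x y T al be [g /= [gi pg]].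
have [|k [kj ki]] := qU _ g (al ∘ se_p T); first by rewrite pg compA.
exists k; split=> //=; apply: qE.
  by rewrite !compA kj gi ji.
have [pi1 _] := se_coker T.
by rewrite !compA ki p'i comp0m -compA pi1 compm0.
Qed.

Definition push a b b' (f : Hom b b') (S : ses a b) : ses a b' :=
  sval (cid (push_ex f S)).
Definition pull a a' b (f : Hom a' a) (S : ses a b) : ses a' b :=
  sval (cid (pull_ex f S)).

Lemma pushP a b b' (f : Hom b b') (S : ses a b) :
  ses_mor (idm a) f S (push f S).
Proof. by have [] := svalP (cid (push_ex f S)). Qed.

Lemma pushU a b b' (f : Hom b b') (S : ses a b) x y (T : ses x y)
    (al : Hom a x) (be : Hom b' y) :
  ses_mor al (be ∘ f) S T -> ses_mor al be (push f S) T.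
Proof. by have [_] := svalP (cid (push_ex f S)); apply. Qed.

Lemma pullP a a' b (f : Hom a' a) (S : ses a b) :
  ses_mor f (idm b) (pull f S) S.
Proof. by have [] := svalP (cid (pull_ex f S)). Qed.

Lemma pullU a a' b (f : Hom a' a) (S : ses a b) x y (T : ses x y)
    (al : Hom x a') (be : Hom y b) :
  ses_mor (f ∘ al) be T S -> ses_mor al be T (pull f S).
Proof. by have [_] := svalP (cid (pull_ex f S)); apply. Qed.

Lemma bipm_kernel a b c a' b' c' (k : Hom a b) (f : Hom b c)
    (k' : Hom a' b') (f' : Hom b' c') :
  is_kernel k f -> is_kernel k' f' -> is_kernel (bipm k k') (bipm f f').
Proof.
move=> kf kf'; have [fk U] := kf; have [fk' U'] := kf'.
apply: is_kernelP.
- apply: mono_eq0 => x g e; apply: bip_homl; rewrite compm0.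
    apply: (kernel_mono kf); rewrite compm0 compA -(pr1_bipm k k').
    by rewrite -compA e compm0.
  apply: (kernel_mono kf'); rewrite compm0 compA -(pr2_bipm k k').
  by rewrite -compA e compm0.
- rewrite bipm_comp fk fk'.
  by apply: bip_homl; rewrite ?pr1_bipm ?pr2_bipm comp0m compm0.
move=> x h e.
have [|u [ku _]] := U _ (pr1 ∘ h).
  by rewrite compA -(pr1_bipm f f') -compA e compm0.
have [|u' [ku' _]] := U' _ (pr2 ∘ h).
  by rewrite compA -(pr2_bipm f f') -compA e compm0.
exists (pairm u u'); rewrite bipm_pairm ku ku'.
by apply: bip_homl; rewrite ?pr1_pairm ?pr2_pairm.
Qed.

Lemma bipm_cokernel a b c a' b' c' (q : Hom b c) (f : Hom a b)
    (q' : Hom b' c') (f' : Hom a' b') :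
  is_cokernel q f -> is_cokernel q' f' -> is_cokernel (bipm q q') (bipm f f').
Proof.
move=> qf qf'; have [fq U] := qf; have [fq' U'] := qf'.
have bi1 x y x' y' (g : Hom x y) (g' : Hom x' y') :
    bipm g g' ∘ in1 = in1 ∘ g.
  by rewrite compDl -!compA pr1in1 pr2in1 compm1 !compm0 addr0.
have bi2 x y x' y' (g : Hom x y) (g' : Hom x' y') :
    bipm g g' ∘ in2 = in2 ∘ g'.
  by rewrite compDl -!compA pr1in2 pr2in2 compm1 !compm0 add0r.
apply: is_cokernelP.
- apply: epi_eq0 => x g e; apply: bip_homr; rewrite comp0m.
    apply: (cokernel_epi qf); rewrite comp0m -compA -(bi1 _ _ _ _ q q').
    by rewrite compA e comp0m.
  apply: (cokernel_epi qf'); rewrite comp0m -compA -(bi2 _ _ _ _ q q').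
  by rewrite compA e comp0m.
- rewrite bipm_comp fq fq'.
  by apply: bip_homl; rewrite ?pr1_bipm ?pr2_bipm comp0m compm0.
move=> x h e.
have [|u [ku _]] := U _ (h ∘ in1).
  by rewrite -compA -(bi1 _ _ _ _ f f') compA e comp0m.
have [|u' [ku' _]] := U' _ (h ∘ in2).
  by rewrite -compA -(bi2 _ _ _ _ f f') compA e comp0m.
exists (copairm u u'); rewrite copairm_bipm ku ku'.
by apply: bip_homr; rewrite ?copairm_in1 ?copairm_in2.
Qed.

Definition ses_sum a b a' b' (S : ses a b) (T : ses a' b') :
    ses (bip a a') (bip b b') :=
  Ses (bipm_kernel (se_ker S) (se_ker T))
      (bipm_cokernel (se_coker S) (se_coker T)).

Lemma split_kernel a b : is_kernel (@in2 A a b) pr1.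
Proof.
apply: is_kernelP; [|exact: pr1in2|].
  apply: mono_eq0 => x g e.
  by rewrite -[g]comp1m -(pr2in2 a b) -compA e compm0.
move=> x h e; exists (pr2 ∘ h).
by apply: bip_homl; rewrite !compA ?e ?pr1in2 ?pr2in2 ?comp0m ?comp1m.
Qed.

Lemma split_cokernel a b : is_cokernel (@pr1 A a b) in2.
Proof.
apply: is_cokernelP; [|exact: pr1in2|].
  apply: epi_eq0 => x g e.
  by rewrite -[g]compm1 -(pr1in1 a b) compA e comp0m.
move=> x h e; exists (h ∘ in1).
by apply: bip_homr; rewrite -!compA ?e ?pr1in1 ?pr1in2 ?compm0 ?compm1.
Qed.

(* 0 -> b -> a (+) b -> a -> 0 *)
Definition ses_split a b : ses a b :=
  Ses (split_kernel a b) (split_cokernel a b).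

Lemma id_kernel a : is_kernel (0 : Hom (zeroob A) a) (idm a).
Proof.
apply: is_kernelP; [|exact: compm0|].
  by apply: mono_eq0 => x g _; apply: hom0r.
by move=> x h; rewrite comp1m => ->; exists 0; rewrite comp0m.
Qed.

Lemma id_cokernel a : is_cokernel (idm a) (0 : Hom (zeroob A) a).
Proof.
apply: is_cokernelP; [|exact: compm0|].
  by move=> x g h; rewrite !compm1.
by move=> x h _; exists h; rewrite compm1.
Qed.

(* 0 -> 0 -> a -> a -> 0 *)
Definition ses_id a : ses a (zeroob A) := Ses (id_kernel a) (id_cokernel a).

(* [extn n a b] is the type of exact sequences                                *)
(*   0 -> b -> e_n.+1 -> ... -> e_1 -> a -> 0                                 *)
(* (note the shift), each written as the Yoneda splice of the n.+1 short      *)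
(* exact sequences it breaks into: 0 -> k -> e_1 -> a -> 0 and a sequence     *)
(* 0 -> b -> e_n.+1 -> ... -> e_2 -> k -> 0                                   *)
Fixpoint extn n a b : Type :=
  if n is m.+1 then {k : A & (ses a k * extn m k b)%type} else ses a b.

(* there is a morphism of exact sequences E -> F which is al on the right     *)
(* ends and be on the left ends                                               *)
Fixpoint extn_mor n a b a' b' (al : Hom a a') (be : Hom b b') :
    extn n a b -> extn n a' b' -> Prop :=
  match n with
  | 0 => fun S T => ses_mor al be S T
  | m.+1 => fun E F => exists ka : Hom (tag E) (tag F),
      ses_mor al ka (tagged E).1 (tagged F).1 /\
      extn_mor ka be (tagged E).2 (tagged F).2
  end.

Fixpoint extn_push n a b b' (f : Hom b b') : extn n a b -> extn n a b' :=
  match n with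
  | 0 => fun S => push f S
  | m.+1 => fun E => existT _ (tag E) ((tagged E).1, extn_push f (tagged E).2)
  end.

Definition extn_pull n a a' b (f : Hom a' a) : extn n a b -> extn n a' b :=
  match n with
  | 0 => fun S => pull f S
  | m.+1 => fun E => existT _ (tag E) (pull f (tagged E).1, (tagged E).2)
  end.

Fixpoint extn_sum n a b a' b' :
    extn n a b -> extn n a' b' -> extn n (bip a a') (bip b b') :=
  match n with
  | 0 => fun S T => ses_sum S T
  | m.+1 => fun E F => existT _ (bip (tag E) (tag F))
      (ses_sum (tagged E).1 (tagged F).1, extn_sum (tagged E).2 (tagged F).2)
  end.

Fixpoint extn_zero n a b : extn n a b :=
  match n with
  | 0 => ses_split a b
  | m.+1 => existT _ (zeroob A) (ses_id a, extn_zero m (zeroob A) b)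
  end.

Definition extn_baer n a b (E F : extn n a b) : extn n a b :=
  extn_pull (diag a) (extn_push (codiag b) (extn_sum E F)).

Lemma extn_mor_id n a b (E : extn n a b) : extn_mor (idm a) (idm b) E E.
Proof.
elim: n a E => [|n IH] a E /=; first exact: ses_mor_id.
by exists (idm _); split; [apply: ses_mor_id | apply: IH].
Qed.

Lemma extn_mor_comp n a b a' b' a'' b'' (al : Hom a a') (be : Hom b b')
    (al' : Hom a' a'') (be' : Hom b' b'')
    (E : extn n a b) (F : extn n a' b') (G : extn n a'' b'') :
  extn_mor al be E F -> extn_mor al' be' F G ->
  extn_mor (al' ∘ al) (be' ∘ be) E G.
Proof.
elim: n a a' a'' al al' E F G => [|n IH] a a' a'' al al' E F G /=.
  exact: ses_mor_comp.
move=> [k [kS kE]] [l [lS lE]]; exists (l ∘ k).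
by split; [apply: ses_mor_comp kS lS | apply: IH kE lE].
Qed.

Lemma extn_pushP n a b b' (f : Hom b b') (E : extn n a b) :
  extn_mor (idm a) f E (extn_push f E).
Proof.
elim: n a E => [|n IH] a E /=; first exact: pushP.
by exists (idm _); split; [apply: ses_mor_id | apply: IH].
Qed.

Lemma extn_pushU n a b b' (f : Hom b b') (E : extn n a b) x y (F : extn n x y)
    (al : Hom a x) (be : Hom b' y) :
  extn_mor al (be ∘ f) E F -> extn_mor al be (extn_push f E) F.
Proof.
elim: n a x E F al => [|n IH] a x E F al /=.
  exact: pushU.
by move=> [k [kS kE]]; exists k; split=> //; apply: IH.
Qed.

Lemma extn_pullP n a a' b (f : Hom a' a) (E : extn n a b) :
  extn_mor f (idm b) (extn_pull f E) E.
Proof.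
case: n E => [|n] E /=; first exact: pullP.
exists (idm _); split; last exact: extn_mor_id.
exact: pullP.
Qed.

Lemma extn_pullU n a a' b (f : Hom a' a) (E : extn n a b) x y (F : extn n x y)
    (al : Hom x a') (be : Hom y b) :
  extn_mor (f ∘ al) be F E -> extn_mor al be F (extn_pull f E).
Proof.
case: n E F => [|n] E F /=.
  exact: pullU.
move=> [k [kS kE]]; exists k; split=> //.
exact: pullU.
Qed.

Lemma extn_sum_mor n a b a' b' c d c' d' (E : extn n a b) (F : extn n a' b')
    (E' : extn n c d) (F' : extn n c' d')
    (al : Hom a c) (be : Hom b d) (al' : Hom a' c') (be' : Hom b' d') :
  extn_mor al be E E' -> extn_mor al' be' F F' ->
  extn_mor (bipm al al') (bipm be be') (extn_sum E F) (extn_sum E' F').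
Proof.
have S0 x y x' y' z t z' t' (S : ses x y) (T : ses x' y') (S' : ses z t)
    (T' : ses z' t') (f : Hom x z) (g : Hom y t) f' g' :
    ses_mor f g S S' -> ses_mor f' g' T T' ->
    ses_mor (bipm f f') (bipm g g') (ses_sum S T) (ses_sum S' T').
  move=> [h [hi ph]] [h' [hi' ph']]; exists (bipm h h').
  by rewrite /= !bipm_comp hi ph hi' ph'.
elim: n a a' c c' E F E' F' al al' => [|n IH] a a' c c' E F E' F' al al' /=.
  exact: S0.
move=> [k [kS kE]] [l [lS lF]]; exists (bipm k l).
by split; [apply: S0 | apply: IH].
Qed.

Definition swapm a b : Hom (bip a b) (bip b a) := pairm pr2 pr1.
Definition assocm a b c : Hom (bip (bip a b) c) (bip a (bip b c)) :=
  pairm (pr1 ∘ pr1) (pairm (pr2 ∘ pr1) pr2).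

Lemma extn_sum_swap n a b a' b' (E : extn n a b) (F : extn n a' b') :
  extn_mor (swapm a a') (swapm b b') (extn_sum E F) (extn_sum F E).
Proof.
have S0 x y x' y' (S : ses x y) (T : ses x' y') :
    ses_mor (swapm x x') (swapm y y') (ses_sum S T) (ses_sum T S).
  exists (swapm _ _) => /=; rewrite !bipm_pairm !pairm_comp.
  by rewrite !pr1_bipm !pr2_bipm.
elim: n a a' E F => [|n IH] a a' E F /=; first exact: S0.
by exists (swapm _ _); split; [apply: S0 | apply: IH].
Qed.

Lemma extn_sum_assoc n a b a' b' a'' b'' (E : extn n a b) (F : extn n a' b')
    (G : extn n a'' b'') :
  extn_mor (assocm a a' a'') (assocm b b' b'')
    (extn_sum (extn_sum E F) G) (extn_sum E (extn_sum F G)).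
Proof.
have S0 x y x' y' x'' y'' (S : ses x y) (T : ses x' y') (U : ses x'' y'') :
    ses_mor (assocm x x' x'') (assocm y y' y'')
      (ses_sum (ses_sum S T) U) (ses_sum S (ses_sum T U)).
  exists (assocm _ _ _) => /=; rewrite !bipm_pairm !pairm_comp -!compA.
  rewrite !pr1_bipm !pr2_bipm.
  by rewrite !(compA pr1) !(compA pr2) !pr1_bipm !pr2_bipm !compA.
elim: n a a' a'' E F G => [|n IH] a a' a'' E F G /=; first exact: S0.
by exists (assocm _ _ _); split; [apply: S0 | apply: IH].
Qed.

Lemma extn_sum_diag n a b (E : extn n a b) :
  extn_mor (diag a) (diag b) E (extn_sum E E).
Proof.
have S0 x y (S : ses x y) : ses_mor (diag x) (diag y) S (ses_sum S S).
  by exists (diag _); rewrite /= !bipm_pairm !pairm_comp !compm1 !comp1m.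
elim: n a E => [|n IH] a E /=; first exact: S0.
by exists (diag _); split; [apply: S0 | apply: IH].
Qed.

Lemma extn_zeroP n a b a' b' (al : Hom a a') (E : extn n a b) :
  extn_mor al (0 : Hom b b') E (extn_zero n a' b').
Proof.
elim: n a a' E al => [|n IH] a a' E al /=.
  exists (in1 ∘ al ∘ se_p E) => /=; rewrite compm0 !compA pr1in1 comp1m.
  by have [pi0 _] := se_ker E; rewrite -compA pi0 compm0.
exists 0; split=> //; exists (al ∘ se_p (tagged E).1) => /=.
by have [pi0 _] := se_ker (tagged E).1; rewrite -compA pi0 !compm0 comp1m.
Qed.

(* the equivalence relation generated by the morphisms of exact sequences     *)
(* which are identities on both ends                                          *)
Definition extn_eq n a b : extn n a b -> extn n a b -> Prop :=
  clos_refl_sym_trans _ (extn_mor (idm a) (idm b)).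

HB.instance Definition _ n a b := gen_eqMixin (extn n a b).
HB.instance Definition _ n a b := gen_choiceMixin (extn n a b).

Definition extn_eqb n a b : rel (extn n a b) := fun E F => `[< extn_eq E F >].

Lemma extn_eqb_refl n a b : reflexive (@extn_eqb n a b).
Proof. by move=> E; apply/asboolP; apply: rst_refl. Qed.

Lemma extn_eqb_sym n a b : symmetric (@extn_eqb n a b).
Proof. by move=> E F; apply/asboolP/asboolP; apply: rst_sym. Qed.

Lemma extn_eqb_trans n a b : transitive (@extn_eqb n a b).
Proof.
move=> F E G /asboolP EF /asboolP FG; apply/asboolP.
exact: rst_trans EF FG.
Qed.

Canonical extn_equiv n a b := EquivRel (@extn_eqb n a b)
  (@extn_eqb_refl n a b) (@extn_eqb_sym n a b) (@extn_eqb_trans n a b).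

Definition yext n a b : Type := {eq_quot extn_equiv n a b}%qT.
HB.instance Definition _ n a b := Choice.on (yext n a b).

Definition cls n a b (E : extn n a b) : yext n a b :=
  (\pi_({eq_quot extn_equiv n a b}) E)%qT.

Lemma clsP n a b (E F : extn n a b) : cls E = cls F <-> extn_eq E F.
Proof.
by split=> [/eqmodP/asboolP // | EF]; apply/eqmodP/asboolP.
Qed.

Lemma cls_surj n a b (e : yext n a b) : exists E, e = cls E.
Proof. by exists (repr e); rewrite /cls reprK. Qed.

Lemma cls_mor n a b (E F : extn n a b) :
  extn_mor (idm a) (idm b) E F -> cls E = cls F.
Proof. by move=> EF; apply/clsP; apply: rst_step. Qed.

Lemma cls_ind n a b T (h : extn n a b -> T) :
  (forall E F, extn_mor (idm a) (idm b) E F -> h E = h F) ->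
  forall E F, cls E = cls F -> h E = h F.
Proof.
move=> hE E F /clsP; elim=> [? ? /hE //|//|? ? _ -> //|? ? ? _ -> _ -> //].
Qed.

Definition yext_push n a b b' (f : Hom b b') (e : yext n a b) : yext n a b' :=
  cls (extn_push f (repr e)).
Definition yext_pull n a a' b (f : Hom a' a) (e : yext n a b) : yext n a' b :=
  cls (extn_pull f (repr e)).
Definition yext_sum n a b a' b' (e : yext n a b) (e' : yext n a' b') :
  yext n (bip a a') (bip b b') := cls (extn_sum (repr e) (repr e')).

Definition yext_zero n a b : yext n a b := cls (extn_zero n a b).
(* Baer sum *)
Definition yext_add n a b (e e' : yext n a b) : yext n a b :=
  cls (extn_baer (repr e) (repr e')).
Definition yext_opp n a b (e : yext n a b) : yext n a b :=
  yext_push (- idm b) e.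
Lemma cls_repr n a b (e : yext n a b) : cls (repr e) = e.
Proof. by rewrite /cls reprK. Qed.

Lemma push_cls n a b b' (f : Hom b b') (E : extn n a b) :
  yext_push f (cls E) = cls (extn_push f E).
Proof.
apply: (@cls_ind _ _ _ _ (fun E => cls (extn_push f E))); last exact: cls_repr.
move=> {}E F EF; apply: cls_mor; apply: extn_pushU; rewrite comp1m.
by have := extn_mor_comp EF (extn_pushP f F); rewrite comp1m compm1.
Qed.

Lemma pull_cls n a a' b (f : Hom a' a) (E : extn n a b) :
  yext_pull f (cls E) = cls (extn_pull f E).
Proof.
apply: (@cls_ind _ _ _ _ (fun E => cls (extn_pull f E))); last exact: cls_repr.
move=> {}E F EF; apply: cls_mor; apply: extn_pullU; rewrite compm1.
by have := extn_mor_comp (extn_pullP f E) EF; rewrite comp1m compm1.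
Qed.

Lemma sum_cls n a b a' b' (E : extn n a b) (F : extn n a' b') :
  yext_sum (cls E) (cls F) = cls (extn_sum E F).
Proof.
rewrite /yext_sum.
transitivity (cls (extn_sum E (repr (cls F)))).
  apply: (@cls_ind _ _ _ _ (fun E => cls (extn_sum E _))); last exact: cls_repr.
  move=> {}E G EG; apply: cls_mor; rewrite -!bipm1.
  by apply: extn_sum_mor => //; apply: extn_mor_id.
apply: (@cls_ind _ _ _ _ (fun F => cls (extn_sum _ F))); last exact: cls_repr.
move=> {}F G FG; apply: cls_mor; rewrite -!bipm1.
by apply: extn_sum_mor => //; apply: extn_mor_id.
Qed.

Lemma yext_addE n a b (e e' : yext n a b) :
  yext_add e e' = yext_pull (diag a) (yext_push (codiag b) (yext_sum e e')).
Proof. by rewrite /yext_sum push_cls pull_cls. Qed.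

Lemma push_pull_mor n a b a' b' (al : Hom a a') (be : Hom b b')
    (E : extn n a b) (F : extn n a' b') :
  extn_mor al be E F -> yext_push be (cls E) = yext_pull al (cls F).
Proof.
move=> EF; rewrite push_cls pull_cls; apply/cls_mor/extn_pullU.
by apply: extn_pushU; rewrite compm1 comp1m.
Qed.

Lemma push_id n a b (e : yext n a b) : yext_push (idm b) e = e.
Proof.
have [E ->] := cls_surj e; rewrite push_cls; apply/esym/cls_mor.
exact: extn_pushP.
Qed.

Lemma pull_id n a b (e : yext n a b) : yext_pull (idm a) e = e.
Proof.
have [E ->] := cls_surj e; rewrite pull_cls; apply/cls_mor.
exact: extn_pullP.
Qed.

Lemma push_comp n a b b' b'' (f : Hom b b') (g : Hom b' b'') (e : yext n a b) :
  yext_push (g ∘ f) e = yext_push g (yext_push f e).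
Proof.
have [E ->] := cls_surj e; rewrite !push_cls; apply/cls_mor/extn_pushU.
rewrite comp1m.
by have := extn_mor_comp (extn_pushP f E) (extn_pushP g _); rewrite comp1m.
Qed.

Lemma pull_comp n a a' a'' b (f : Hom a' a) (g : Hom a'' a') (e : yext n a b) :
  yext_pull (f ∘ g) e = yext_pull g (yext_pull f e).
Proof.
have [E ->] := cls_surj e; rewrite !pull_cls; apply/esym/cls_mor/extn_pullU.
rewrite compm1.
by have := extn_mor_comp (extn_pullP g _) (extn_pullP f E); rewrite comp1m.
Qed.

Lemma push_pull n a a' b b' (f : Hom a' a) (g : Hom b b') (e : yext n a b) :
  yext_push g (yext_pull f e) = yext_pull f (yext_push g e).
Proof.
have [E ->] := cls_surj e; rewrite pull_cls [in RHS]push_cls.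
apply: push_pull_mor.
have := extn_mor_comp (extn_pullP f E) (extn_pushP g E).
by rewrite comp1m compm1.
Qed.

Lemma push_pull_sum n a b a' b' c d c' d' (e : yext n a b) (e' : yext n a' b')
    (f : Hom c a) (g : Hom b d) (f' : Hom c' a') (g' : Hom b' d') :
  yext_sum (yext_pull f (yext_push g e)) (yext_pull f' (yext_push g' e')) =
  yext_pull (bipm f f') (yext_push (bipm g g') (yext_sum e e')).
Proof.
have [E ->] := cls_surj e; have [E' ->] := cls_surj e'.
rewrite [in RHS]sum_cls !push_cls [in LHS]pull_cls.
rewrite [X in yext_sum _ X]pull_cls [in LHS]sum_cls.
rewrite -[LHS]push_id -bipm1.
rewrite (push_pull_mor (extn_sum_mor (extn_pullP f _) (extn_pullP f' _))).
congr (yext_pull _ _); rewrite -push_cls -[LHS]pull_id -bipm1; apply: esym.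
by apply: push_pull_mor; apply: extn_sum_mor; apply: extn_pushP.
Qed.

Lemma sum_pull_push n a b a' b' d (c : A) (e : yext n a b) (e' : yext n a' b')
    (f : Hom c a) (g : Hom b d) :
  yext_sum (yext_pull f (yext_push g e)) e' =
  yext_pull (bipm f (idm a')) (yext_push (bipm g (idm b')) (yext_sum e e')).
Proof. by rewrite -push_pull_sum push_id pull_id. Qed.

Lemma sum_pull_push_r n a b a' b' d (c : A) (e : yext n a b)
    (e' : yext n a' b') (f : Hom c a') (g : Hom b' d) :
  yext_sum e (yext_pull f (yext_push g e')) =
  yext_pull (bipm (idm a) f) (yext_push (bipm (idm b) g) (yext_sum e e')).
Proof. by rewrite -push_pull_sum push_id pull_id. Qed.

Lemma yext_addC n a b : commutative (@yext_add n a b).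
Proof.
move=> e e'; rewrite !yext_addE.
have [E ->] := cls_surj e; have [E' ->] := cls_surj e'.
rewrite !sum_cls.
have -> : codiag b = codiag b ∘ swapm b b.
  by rewrite /codiag /swapm copairm_pairm !comp1m addrC /copairm !comp1m.
rewrite push_comp (push_pull_mor (extn_sum_swap E E')) push_pull -pull_comp.
congr yext_pull; last first.
  congr yext_push.
  by rewrite /codiag /swapm copairm_pairm !comp1m addrC /copairm !comp1m.
by rewrite /diag /swapm pairm_comp pr1_pairm pr2_pairm.
Qed.

Lemma yext_addA n a b : associative (@yext_add n a b).
Proof.
move=> e1 e2 e3; apply/esym; rewrite !yext_addE sum_pull_push sum_pull_push_r.
rewrite !push_pull -!pull_comp -!push_comp.
have [E1 ->] := cls_surj e1; have [E2 ->] := cls_surj e2.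
have [E3 ->] := cls_surj e3; rewrite !sum_cls.
have -> : codiag b ∘ bipm (codiag b) (idm b) =
          codiag b ∘ bipm (idm b) (codiag b) ∘ assocm b b b.
  rewrite /codiag /assocm [in LHS]copairm_bipm -compA bipm_pairm !copairm_pairm.
  by rewrite !comp1m /copairm !comp1m compDl addrA.
rewrite [in LHS]push_comp (push_pull_mor (extn_sum_assoc E1 E2 E3)).
rewrite push_pull -pull_comp; congr yext_pull.
rewrite /diag /assocm !bipm_pairm !compm1 !pairm_comp -!compA.
by rewrite !pr1_pairm !pr2_pairm.
Qed.

Lemma yext_pushD n a b b' (f g : Hom b b') (e : yext n a b) :
  yext_push (f + g) e = yext_add (yext_push f e) (yext_push g e).
Proof.
rewrite yext_addE -[yext_push f e]pull_id -[yext_push g e]pull_id.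
rewrite push_pull_sum bipm1 pull_id -push_comp.
have [E ->] := cls_surj e; rewrite !sum_cls.
rewrite -push_pull -(push_pull_mor (extn_sum_diag E)) -push_comp.
congr (yext_push _ _).
by rewrite /codiag copairm_bipm copairm_pairm !compm1 !comp1m.
Qed.

Lemma yext_push0 n a b b' (e : yext n a b) :
  yext_push (0 : Hom b b') e = yext_zero n a b'.
Proof.
have [E ->] := cls_surj e.
by rewrite (push_pull_mor (extn_zeroP b' (idm a) E)) pull_id.
Qed.

Lemma yext_add0 n a b : left_id (yext_zero n a b) (@yext_add n a b).
Proof.
move=> e; rewrite -[in LHS](yext_push0 b e) -{2}[e]push_id -yext_pushD.
by rewrite add0r push_id.
Qed.

Lemma yext_addN n a b :
  left_inverse (yext_zero n a b) (@yext_opp n a b) (@yext_add n a b).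
Proof.
move=> e; rewrite /yext_opp -{2}[e]push_id -yext_pushD.
by rewrite addNr yext_push0.
Qed.

HB.instance Definition _ n a b := GRing.isZmodule.Build (yext n a b)
  (@yext_addA n a b) (@yext_addC n a b) (@yext_add0 n a b) (@yext_addN n a b).

Lemma yext_push_is_nmod_morphism n a b b' (f : Hom b b') :
  nmod_morphism (@yext_push n a b b' f).
Proof.
split.
  have -> : (0 : yext n a b) = yext_push (0 : Hom b b) (0 : yext n a b).
    by rewrite yext_push0.
  by rewrite -push_comp compm0 yext_push0.
move=> e e'; rewrite -![_ + _]/(yext_add _ _) !yext_addE push_pull.
rewrite -[yext_push f e]pull_id -[yext_push f e']pull_id.
rewrite push_pull_sum bipm1 pull_id -!push_comp.
congr (yext_pull _ (yext_push _ _)).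
by rewrite /codiag copairm_comp copairm_bipm !compm1 !comp1m.
Qed.

HB.instance Definition _ n a b b' (f : Hom b b') :=
  GRing.isNmodMorphism.Build (yext n a b) (yext n a b') (yext_push f)
    (@yext_push_is_nmod_morphism n a b b' f).

Definition hom_push a b b' (f : Hom b b') (g : Hom a b) : Hom a b' := f ∘ g.

Lemma hom_push_is_nmod_morphism a b b' (f : Hom b b') :
  nmod_morphism (@hom_push a b b' f).
Proof. by split=> [|g h]; [apply: compm0 | apply: compDr]. Qed.

HB.instance Definition _ a b b' (f : Hom b b') :=
  GRing.isNmodMorphism.Build (Hom a b) (Hom a b') (hom_push f)
    (@hom_push_is_nmod_morphism a b b' f).

Definition Ext n a b : zmodType := if n is m.+1 then yext m a b else Hom a b.

(* Ext^n(a, f) : Ext^n(a, b) -> Ext^n(a, b') *)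
Definition Extmap n a b b' (f : Hom b b') :
    {additive Ext n a b -> Ext n a b'} :=
  match n with
  | 0 => hom_push f
  | m.+1 => yext_push f
  end.

End Exact.

(* A finite sequence of morphisms x_(k-1) -> ... -> x_0 is given by functions *)
(* on nat, of which only the first k terms (and k-1 morphisms) are used.      *)

Section ExactSequence.
Variables (k : nat) (G : nat -> zmodType).
Variable delta : forall i, {additive G i.+1 -> G i}.

Definition incoming_image i (z : G i) : Prop :=
  if (i.+1 < k)%N then exists y : G i.+1, delta i y = z else z = 0.

Definition outgoing_kernel i : G i -> Prop :=
  match i with
  | 0 => fun _ => True
  | j.+1 => fun z => delta j z = 0
  end.

(* exactness of 0 -> G_(k-1) -> ... -> G_0 -> 0 *)
Definition exact_ab :=
  forall i, (i < k)%N -> forall z : G i, outgoing_kernel z <-> incoming_image z.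

End ExactSequence.

Section ClusterTilting.
Variable A : abelian.
Variable n : nat.
Implicit Types M X : A -> Prop.

(* full subcategories of A are given by predicates on objects *)

Definition Ext_exact (j : nat) (x : A) (r : nat -> A)
    (d : forall i, Hom (r i.+1) (r i)) :=
  exact_ab n (fun i => Extmap j x (d i)).

Record cluster_tilting M : Prop := ClusterTilting {
  ct_additive : forall (I : finType) (x : I -> A),
    (forall i, M (x i)) -> exists2 s, is_dirsum x s & M s;
  ct_right_approx : forall a : A, exists (m : A) (f : Hom m a), M m /\
    forall (m' : A) (g : Hom m' a), M m' -> exists h : Hom m' m, f ∘ h = g;
  ct_left_approx : forall a : A, exists (m : A) (f : Hom a m), M m /\
    forall (m' : A) (g : Hom a m'), M m' -> exists h : Hom m m', h ∘ f = g;
  ct_generating : forall a : A, exists (m : A) (f : Hom m a), M m /\ epi f;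
  ct_cogenerating : forall a : A, exists (m : A) (f : Hom a m), M m /\ mono f;
  ct_Ext_right : forall a : A, M a <->
    (forall i, (0 < i < n)%N -> forall m, M m -> forall e : Ext i m a, e = 0);
  ct_Ext_left : forall a : A, M a <->
    (forall i, (0 < i < n)%N -> forall m, M m -> forall e : Ext i a m, e = 0)
}.

(* the class X-exact_n; the term m_i of the sequence m_n -> ... -> m_1 is     *)
(* r (i - 1)                                                                  *)
Definition exact_class M X (r : nat -> A) (d : forall i, Hom (r i.+1) (r i)) :=
  (forall i, (i < n)%N -> M (r i)) /\ forall x, X x -> Ext_exact n x d.

Definition perp_exact M X (m : A) :=
  M m /\ forall (r : nat -> A) (d : forall i, Hom (r i.+1) (r i)),
    exact_class M X d -> Ext_exact n m d.

Definition cotorsion_class M X := forall m, X m <-> perp_exact M X m.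

(* epimorphisms of the category M *)
Definition epi_in M (a b : A) (f : Hom a b) :=
  forall c (g h : Hom b c), M c -> g ∘ f = h ∘ f -> g = h.

Definition projective_in M (p : A) :=
  M p /\ forall (a b : A) (f : Hom a b), M a -> M b -> epi_in M f ->
    forall g : Hom p b, exists h : Hom p a, f ∘ h = g.

(* 0 -> m_n.+1 -> m_n -> ... -> m_1 -> m_0 -> 0 *)
Definition n_exact M (m : nat -> A) (d : forall i, Hom (m i.+1) (m i)) :=
  [/\ forall i, (i <= n.+1)%N -> M (m i),
      mono (d n),
      forall i, (i < n)%N -> exact_at (d i.+1) (d i)
    & epi (d 0%N)].

Definition syzygy M (k x : A) :=
  exists (m : nat -> A) (d : forall i, Hom (m i.+1) (m i)),
  [/\ n_exact M d,
      forall i, (0 < i <= n)%N -> projective_in M (m i),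
      m n.+1 = k
    & m 0%N = x].

Definition closed_under_syzygies M X :=
  forall x, X x -> exists2 k, syzygy M k x & X k.

End ClusterTilting.

(* Main.v *)
From mathcomp Require Import all_boot ssralg boolp.
Require Import Defs.

(** A projective object of M is projective in A, since M is generating;
    hence Ext^j(p, -) = 0 for j > 0, and a short exact sequence
    0 -> k -> p -> a -> 0 with p projective gives natural bijections
    Ext^j(k, -) -> Ext^(j+1)(a, -), by splicing.  Breaking an n-exact sequence
    0 -> k -> p_n -> ... -> p_1 -> x -> 0 into short exact sequences yields
    Ext^(n(i+1))(x, -) = Ext^(ni)(k, -), so (iii) follows by induction on i.
    For (i), Ext^j(-, b) is additive in the first variable. *)

Set Implicit Arguments.
Unset Strict Implicit.
Unset Printing Implicit Defensive.

Import GRing.Theory.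

(** * Yoneda Ext in the first variable *)

Section ExtPull.
Local Open Scope ring_scope.
Variable A : abelian.
Implicit Types a b c x p : A.

(** Dual to [extn_sum_diag]; it makes [yext_pull] additive in the morphism, as the diagonal does for
    [yext_push]. *)
Lemma extn_sum_codiag n a b (E : extn n a b) :
  extn_mor (codiag a) (codiag b) (extn_sum E E) E.
Proof.
have S0 x y (S : ses x y) : ses_mor (codiag x) (codiag y) (ses_sum S S) S.
  by exists (codiag _); rewrite /= !copairm_bipm !copairm_comp !compm1 !comp1m.
elim: n a E => [|n IH] a E /=; first exact: S0.
by exists (codiag _); split; [apply: S0 | apply: IH].
Qed.

Lemma yext_pullD n a a' b (f g : Hom a' a) (e : yext n a b) :
  yext_pull (f + g) e = yext_pull f e + yext_pull g e.
Proof.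
rewrite -[_ + _ in RHS]/(yext_add _ _) yext_addE.
rewrite -{2}[e]push_id -{3}[e]push_id push_pull_sum bipm1 push_id.
rewrite push_pull -pull_comp.
have [E ->] := cls_surj e; rewrite sum_cls (push_pull_mor (extn_sum_codiag E)).
rewrite -pull_comp; congr (yext_pull _ _).
by rewrite /diag bipm_pairm copairm_pairm !compm1 !comp1m.
Qed.

Lemma yext_pull0l n a a' b (e : yext n a b) :
  yext_pull (0 : Hom a' a) e = 0.
Proof.
by apply: (addIr (yext_pull 0 e)); rewrite -yext_pullD !add0r.
Qed.

Lemma yext_pull0r n a a' b (f : Hom a' a) : yext_pull f (0 : yext n a b) = 0.
Proof.
have e0 c (e : yext n c b) : yext_push (0 : Hom b b) e = 0 by exact: yext_push0.
by rewrite -(e0 a 0) -push_pull e0.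
Qed.

Lemma yext_pull_sum n a a' b (I : finType) (f : I -> Hom a' a)
    (e : yext n a b) :
  yext_pull (\sum_i f i) e = \sum_i yext_pull (f i) e.
Proof.
elim/big_rec2: _ => [|i y h _ <-]; first exact: yext_pull0l.
by rewrite yext_pullD.
Qed.

(** Yoneda product with the class of [S]; the index [m] stands for degree m + 1. *)
Definition ext_splice m a k b (S : ses a k) (e : yext m k b) : yext m.+1 a b :=
  cls (existT _ k (S, repr e) : extn m.+1 a b).

Lemma splice_cls m a k b (S : ses a k) (E : extn m k b) :
  ext_splice S (cls E) = cls (existT _ k (S, E) : extn m.+1 a b).
Proof.
pose h F : yext m.+1 a b := cls (existT _ k (S, F) : extn m.+1 a b).
apply: (@cls_ind _ _ _ _ _ h); last exact: cls_repr.
move=> {}E F EF; apply: cls_mor; exists (idm k).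
by split=> //; apply: ses_mor_id.
Qed.

Lemma splice_push m a k b b' (S : ses a k) (f : Hom b b') (e : yext m k b) :
  ext_splice S (yext_push f e) = yext_push f (ext_splice S e).
Proof.
by have [E ->] := cls_surj e; rewrite push_cls !splice_cls push_cls.
Qed.

Lemma splice0 m a k b (S : ses a k) : ext_splice S (0 : yext m k b) = 0.
Proof.
have e0 j c (e : yext j c b) : yext_push (0 : Hom b b) e = 0.
  exact: yext_push0.
by rewrite -(e0 _ _ 0) splice_push e0.
Qed.

(** Up to equivalence [T] is the pushout of [S] along [f], so this is the balancing relation of the
    Yoneda product. *)
Lemma splice_pull m a k k' b (S : ses a k) (T : ses a k') (f : Hom k k')
    (e : yext m k' b) :
  ses_mor (idm a) f S T -> ext_splice S (yext_pull f e) = ext_splice T e.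
Proof.
move=> ST; have [E ->] := cls_surj e; rewrite pull_cls !splice_cls.
by apply: cls_mor; exists f; split=> //; apply: extn_pullP.
Qed.

Definition projective p :=
  forall a b (f : Hom a b), epi f -> forall g : Hom p b, exists h, f ∘ h = g.

Lemma projective_yext0 p : projective p ->
  forall m b (e : yext m p b), e = 0.
Proof.
move=> pp; case=> [|m] b e; have [E ->] := cls_surj e.
  have [s ps] := pp _ _ _ (cokernel_epi (se_coker E)) (idm p).
  apply/esym/cls_mor; exists (copairm s (se_i E)) => /=.
  rewrite copairm_in2 compm1 comp1m; split=> //.
  have [pi0 _] := se_ker E.
  apply: bip_homr; rewrite -compA ?copairm_in1 ?copairm_in2.
    by rewrite ps pr1in1.
  by rewrite pi0 pr1in2.
case: E => k [T G]; rewrite -splice_cls.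
have [s ps] := pp _ _ _ (cokernel_epi (se_coker T)) (idm p).
(* The section [s] gives a morphism from 0 -> 0 -> p -> p -> 0 to [T], so the class is a splice with
   a pullback along 0. *)
rewrite -(@splice_pull _ _ _ _ _ (ses_id p) T 0); last first.
  by exists s; rewrite /= !compm0 ps comp1m.
by rewrite yext_pull0l splice0.
Qed.

(** * Dimension shifting along a projective middle term *)

Section DimensionShift.
Variables (a k : A) (S : ses a k).
Hypothesis proj_mid : projective (se_mid S).

Lemma lift_ex k' (T : ses a k') : exists f : Hom k k', ses_mor (idm a) f S T.
Proof.
have [g pg] := proj_mid (cokernel_epi (se_coker T)) (se_p S).
have [_ U] := se_ker T; have [pi0 _] := se_ker S.
have [|f [fg _]] := U _ (g ∘ se_i S); first by rewrite compA pg.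
by exists f, g; rewrite fg pg comp1m.
Qed.

(* The difference of two liftings factors through the projective object, whose
   Ext vanishes. *)
Lemma lift_uniq m k' b (T : ses a k') (f g : Hom k k') (e : yext m k' b) :
  ses_mor (idm a) f S T -> ses_mor (idm a) g S T ->
  yext_pull f e = yext_pull g e.
Proof.
move=> [F [Fi pF]] [G [Gi pG]]; have [_ U] := se_ker T.
have [|h [hU _]] := U _ (F - G); first by rewrite compDr compmN pF pG subrr.
have -> : f = g + h ∘ se_i S.
  apply: (kernel_mono (se_ker T)); rewrite compDr compA hU compDl compNm.
  by rewrite Fi Gi addrC subrK.
rewrite yext_pullD pull_comp (projective_yext0 proj_mid (yext_pull h e)).
by rewrite yext_pull0r addr0.
Qed.

Definition lift k' (T : ses a k') : Hom k k' := sval (cid (lift_ex T)).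

Lemma liftP k' (T : ses a k') : ses_mor (idm a) (lift T) S T.
Proof. exact: svalP (cid (lift_ex T)). Qed.

(** Inverse of splicing with [S]: compare [S] with the first short exact sequence of [E], then pull
    back the rest. *)
Definition unsplice_extn m b (E : extn m.+1 a b) : yext m k b :=
  yext_pull (lift (tagged E).1) (cls (tagged E).2).

Lemma unsplice_extn_mor m b (E F : extn m.+1 a b) :
  extn_mor (idm a) (idm b) E F -> unsplice_extn E = unsplice_extn F.
Proof.
case: E F => [k1 [T1 G1]] [k2 [T2 G2]] [l /= [lT lG]]; rewrite /unsplice_extn /=.
rewrite -[cls G1]push_id (push_pull_mor lG) -pull_comp.
(* The lift to [T1] followed by [l] is another lifting to [T2]. *)
apply: lift_uniq (liftP _).
by rewrite -[idm a]comp1m; apply: ses_mor_comp (liftP _) lT.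
Qed.

Definition unsplice m b (e : yext m.+1 a b) : yext m k b :=
  unsplice_extn (repr e).

Lemma unsplice_cls m b (E : extn m.+1 a b) : unsplice (cls E) = unsplice_extn E.
Proof. exact: (cls_ind (@unsplice_extn_mor m b)) (cls_repr _). Qed.

Lemma spliceK m b : cancel (@ext_splice m a k b S) (@unsplice m b).
Proof.
move=> e; have [E ->] := cls_surj e.
rewrite splice_cls unsplice_cls /unsplice_extn /=.
by rewrite (lift_uniq _ (liftP S) (ses_mor_id S)) pull_id.
Qed.

Lemma unspliceK m b : cancel (@unsplice m b) (@ext_splice m a k b S).
Proof.
move=> e; have [[k' [T G]] ->] := cls_surj e; rewrite unsplice_cls.
by rewrite (splice_pull _ (liftP T)) splice_cls.
Qed.

End DimensionShift.

End ExtPull.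

(** * Exactness of retracts *)

Section Retract.
Local Open Scope ring_scope.

(* No additivity of [phi] and [psi] is required, which saves proving it for
   splicing.  The empty family is allowed; it says that all [G i] vanish. *)
Lemma exact_ab_retract k (G : nat -> zmodType)
    (delta : forall i, {additive G i.+1 -> G i})
    (I : finType) (G' : I -> nat -> zmodType)
    (delta' : forall j i, {additive G' j i.+1 -> G' j i})
    (phi : forall j i, G i -> G' j i) (psi : forall j i, G' j i -> G i) :
  (forall j i, phi j i 0 = 0) -> (forall j i, psi j i 0 = 0) ->
  (forall j i z, phi j i (delta i z) = delta' j i (phi j i.+1 z)) ->
  (forall j i z, psi j i (delta' j i z) = delta i (psi j i.+1 z)) ->
  (forall i z, \sum_j psi j i (phi j i z) = z) ->
  (forall j, exact_ab k (delta' j)) -> exact_ab k delta.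
Proof.
move=> phi0 psi0 phiN psiN sumK ex i ik z; split.
- move=> oz; have ophi j : outgoing_kernel (delta' j) (phi j i z).
    by case: i z oz {ik} => [//|i] z /= z0; rewrite -phiN z0.
  have iphi j := proj1 (ex j i ik _) (ophi j).
  rewrite /incoming_image in iphi *; case: ifP iphi => [_|_] iphi.
    (* Choose preimages of the components of [z]; their images under [psi] add up to a preimage of
       [z]. *)
    pose y j := sval (cid (iphi j)); have yP j := svalP (cid (iphi j)).
    exists (\sum_j psi j i.+1 (y j)); rewrite raddf_sum -[RHS]sumK.
    by apply: eq_bigr => j _; rewrite -psiN (yP j).
  by rewrite -[z]sumK; apply: big1 => j _; rewrite iphi.
- move=> iz; have iphi j : incoming_image k (delta' j) (phi j i z).
    rewrite /incoming_image in iz *; case: ifP iz => [_ [y <-]|_ ->] //.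
    by exists (phi j i.+1 y); rewrite phiN.
  have ophi j := proj2 (ex j i ik _) (iphi j).
  case: i z iz {ik iphi} ophi => [//|i] z _ /= ophi.
  rewrite -[delta i z]sumK; apply: big1 => j _.
  by rewrite phiN ophi psi0.
Qed.

End Retract.

(** * Transfer of exactness between Ext sequences *)

Section Cotorsion.
Local Open Scope ring_scope.
Variables (A : abelian).
Implicit Types a b c x : A.

(** The hypothesis makes [s] a retract of the sum of the [x i], which treats direct summands
    (one-element family) and direct sums at once. *)
Lemma Ext_exact_family l m (I : finType) (x : I -> A) (s : A)
    (f : forall i, Hom (x i) s) (g : forall i, Hom s (x i))
    (r : nat -> A) (d : forall i, Hom (r i.+1) (r i)) :
  \sum_i f i ∘ g i = idm s ->
  (forall i, Ext_exact l m.+1 (x i) d) -> Ext_exact l m.+1 s d.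
Proof.
move=> fg; apply: (@exact_ab_retract _ _ _ I
  (fun j i => yext m (x j) (r i)) _
  (fun j i => yext_pull (f j)) (fun j i => yext_pull (g j))).
- by move=> j i; apply: yext_pull0r.
- by move=> j i; apply: yext_pull0r.
- by move=> j i z; rewrite /= push_pull.
- by move=> j i z; rewrite /= push_pull.
move=> i z; rewrite -[RHS]pull_id -fg yext_pull_sum.
by apply: eq_bigr => j _; rewrite pull_comp.
Qed.

Lemma yext0_family m (I : finType) (x : I -> A) (s b : A)
    (f : forall i, Hom (x i) s) (g : forall i, Hom s (x i)) :
  \sum_i f i ∘ g i = idm s ->
  (forall i (e : yext m (x i) b), e = 0) -> forall e : yext m s b, e = 0.
Proof.
move=> fg e0 e; rewrite -[e]pull_id -fg yext_pull_sum; apply: big1 => j _.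
by rewrite pull_comp (e0 j (yext_pull _ e)) yext_pull0r.
Qed.

Lemma Ext_exact_iso l m a b (f : Hom a b) (g : Hom b a)
    (r : nat -> A) (d : forall i, Hom (r i.+1) (r i)) :
  f ∘ g = idm b -> Ext_exact l m.+1 a d -> Ext_exact l m.+1 b d.
Proof.
move=> fg ea; apply: (@Ext_exact_family _ _ 'I_1 (fun=> a) b
  (fun=> f) (fun=> g)) => //.
by rewrite big_ord1.
Qed.

Lemma Ext_exact_projective l m p
    (r : nat -> A) (d : forall i, Hom (r i.+1) (r i)) :
  projective p -> Ext_exact l m.+1 p d.
Proof.
(* The empty family applies because Ext of [p] vanishes in positive degrees. *)
move=> pp; apply: (@exact_ab_retract _ _ _ 'I_0
  (fun _ i => yext m p (r i)) (fun _ i => yext_push (d i))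
  (fun _ _ => id) (fun _ _ => id)) => // [i z|[]//].
by rewrite big_ord0 (projective_yext0 pp z).
Qed.

Lemma Ext_exact_shift l m a k (S : ses a k)
    (r : nat -> A) (d : forall i, Hom (r i.+1) (r i)) :
  projective (se_mid S) -> Ext_exact l m.+1 k d -> Ext_exact l m.+2 a d.
Proof.
move=> pS ek; apply: (@exact_ab_retract _ _ _ 'I_1
  (fun _ i => yext m k (r i)) (fun _ i => yext_push (d i))
  (fun _ i => unsplice pS (b := r i)) (fun _ i => ext_splice S)) => //=.
(* [unsplice] inherits preservation of 0 and naturality from its inverse [ext_splice]. *)
- by move=> _ i; rewrite -[RHS](spliceK pS) splice0.
- by move=> _ i; apply: splice0.
- move=> _ i z; rewrite -[RHS](spliceK pS) splice_push.
  by rewrite (unspliceK pS z).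
- by move=> _ i z; rewrite splice_push.
by move=> i z; rewrite big_ord1 unspliceK.
Qed.

Section Category.
Variables (n : nat) (M X : A -> Prop).
Hypothesis M_ct : cluster_tilting n M.

(** The pullback of [f] along [g] is an epimorphism onto [p]; covering its source by an object of
    [M] gives an epimorphism in [M], whose section yields the lift. *)
Lemma projective_in_projective p : projective_in M p -> projective p.
Proof.
move=> [Mp pM] a b f fe g.
have [q U] := pull_ex g (Ses (kerP f) (epi_cokernel fe (kerP f))).
case: U => -[h /= [_ hq]] _.
have [m [t [Mm te]]] := ct_generating M_ct (se_mid q).
have qe := cokernel_epi (se_coker q).
have [|s ps] := pM m p (se_p q ∘ t) Mm Mp _ (idm p).
  by move=> c u v _; rewrite !compA => /te/qe.
by exists (h ∘ t ∘ s); rewrite !compA hq -!compA [se_p q ∘ _]compA ps compm1.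
Qed.

Lemma cluster_tilting_family (I : finType) (x : I -> A) (s : A)
    (f : forall i, Hom (x i) s) (g : forall i, Hom s (x i)) :
  \sum_i f i ∘ g i = idm s -> (forall i, M (x i)) -> M s.
Proof.
move=> fg Mx; apply/(ct_Ext_left M_ct) => -[//|j] jn m Mm.
apply: (yext0_family fg) => i.
exact: (proj1 (ct_Ext_left M_ct (x i)) (Mx i) j.+1 jn m Mm).
Qed.

Lemma perp_exact_family (I : finType) (x : I -> A) (s : A)
    (f : forall i, Hom (x i) s) (g : forall i, Hom s (x i)) :
  (0 < n)%N -> \sum_i f i ∘ g i = idm s ->
  (forall i, perp_exact n M X (x i)) -> perp_exact n M X s.
Proof.
move=> n0 fg Px; split.
  by apply: (cluster_tilting_family fg) => i; have [] := Px i.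
move=> r d rd; move: (fun i => proj2 (Px i) r d rd).
by rewrite -(prednK n0); apply: Ext_exact_family fg.
Qed.

End Category.

(** * Breaking an n-exact sequence into short exact sequences *)

(** If [h] kills [e], then [f] factors through the subobject [ker h] of [k], which therefore
    contains the image of [f]; by exactness this is all of [k]. *)
Lemma epi_of_exact a b c k (f : Hom a b) (g : Hom b c) (i : Hom k b)
    (e : Hom a k) :
  exact_at f g -> is_kernel i g -> i ∘ e = f -> epi e.
Proof.
move=> fg ig ie; apply: epi_eq0 => t h he.
have [gi U] := ig; have [_ V] := fg.
have [_ W] := kerP h; have [e' [te' _]] := W _ _ he.
have km : mono (i ∘ ker h).
  by move=> z u v; rewrite -!compA => /(kernel_mono ig)/(kernel_mono (kerP h)).
have [w0 [w [wk wU]]] := mono_normal km.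
have wf : w ∘ f = 0 by rewrite -ie -te' !compA -(compA w) wk comp0m.
have [_ C] := cokerP f; have [w' [w'E _]] := C _ _ wf.
have [v [iv _]] := V _ _ gi.
have [qv _] := kerP (coker f).
have wi : w ∘ i = 0 by rewrite -w'E -compA -iv (compA (coker f)) qv comp0m compm0.
have [u [iu _]] := wU _ _ wi.
have hu : ker h ∘ u = idm k.
  by apply: (kernel_mono ig); rewrite compA iu compm1.
have [hk _] := kerP h.
by rewrite -[h]compm1 -hu compA hk comp0m.
Qed.

(** Abelian categories are balanced: [q] is the cokernel of its zero kernel, so [idm a] factors
    through [q]. *)
Lemma mono_epi_section a b (q : Hom a b) :
  mono q -> epi q -> exists g : Hom b a, q ∘ g = idm b.
Proof.
move=> qm qe; have [_ U] := epi_cokernel qe (kerP q).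
have [qk _] := kerP q.
have [|g [gq _]] := U _ (idm a).
  by rewrite comp1m; apply: qm; rewrite qk compm0.
by exists g; apply: qe; rewrite -compA gq compm1 comp1m.
Qed.

Lemma Ext_exact_n_exact n (M : A -> Prop) (m : nat -> A)
    (d : forall i, Hom (m i.+1) (m i)) l j
    (r : nat -> A) (dr : forall i, Hom (r i.+1) (r i)) :
  n_exact n M d -> (forall i, (0 < i <= n)%N -> projective (m i)) ->
  Ext_exact l j.+1 (m n.+1) dr -> Ext_exact l (j + n).+1 (m 0%N) dr.
Proof.
move=> [_ dm dex de] mp ek.
(* Here [c] plays the image of [d i], known only through an epimorphism [q] with the same kernel as
   [d i]. *)
suff H i : (i <= n)%N -> exists c (q : Hom (m i.+1) c), [/\ epi q,
    forall t (h : Hom t (m i.+1)), q ∘ h = 0 <-> d i ∘ h = 0 &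
    forall j, Ext_exact l j.+1 c dr -> Ext_exact l (j + i).+1 (m 0%N) dr].
  have [c [q [qe qd qE]]] := H n (leqnn n).
  (* At i = n, [d n] is mono, so [q] is invertible and [m n.+1] replaces [c]. *)
  have qm : mono q.
    by apply: mono_eq0 => t h /qd dh0; apply: dm; rewrite dh0 compm0.
  have [g qg] := mono_epi_section qm qe.
  exact/qE/(Ext_exact_iso qg).
elim: i => [|i IH] lein.
  by exists (m 0%N), (d 0%N); split=> // j'; rewrite addn0.
have [c [q [qe qd qE]]] := IH (ltnW lein).
have dq : q ∘ d i.+1 = 0.
  apply/qd; have [d0 U] := dex i lein.
  have [_ C] := kerP (coker (d i.+1)); have [cd _] := cokerP (d i.+1).
  have [u [du _]] := C _ _ cd.
  by rewrite -du compA d0 comp0m.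
have [_ U] := kerP q; have [q' [qq' _]] := U _ _ dq.
(* The next image is the kernel of [q], onto which [d i.+1] maps by exactness. *)
exists (kerob q), q'; split.
- apply: epi_of_exact (dex i lein) _ qq'.
  have [qk _] := kerP q; apply: is_kernelP; first exact: kernel_mono (kerP q).
    exact/qd.
  by move=> t h /qd/U[u [ku _]]; exists u.
- move=> t h; rewrite -qq' -compA; split=> [->|]; first by rewrite compm0.
  by move=> e; apply: (kernel_mono (kerP q)); rewrite compm0.
move=> j' eK; rewrite addnS -addSn; apply: qE.
(* The middle term [m i.+1] is projective since 0 < i + 1 <= n. *)
apply: (Ext_exact_shift (S := Ses (kerP q) (epi_cokernel qe (kerP q)))) eK.
exact: mp.
Qed.

End Cotorsion.

Theorem proposition3p2 (A : abelian) (n : nat) (M X : A -> Prop)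
    (n_ge1 : (1 <= n)%N)
    (M_ct : cluster_tilting n M)
    (X_sub_M : forall a : A, X a -> M a)
    (X_cotorsion : cotorsion_class n M X) :
  [/\ (forall x y : A, X x -> direct_summand y x -> X y) /\
      (forall (I : finType) (x : I -> A) (s : A),
         (forall i, X (x i)) -> is_dirsum x s -> X s),
      forall p : A, projective_in M p -> X p
    & closed_under_syzygies n M X ->
      forall (r : nat -> A) (d : forall i, Hom (r i.+1) (r i)),
        exact_class n M X d ->
        forall (x : A) (i : nat), X x -> (1 <= i)%N ->
          Ext_exact n (n * i) x d].
Proof.
split; [split | |].
- move=> x y Xx [z [f [g [gf _ _]]]]; apply/X_cotorsion.
  (* A summand is a retract: projection after inclusion is the identity of [y]. *)
  apply: (@perp_exact_family _ _ _ _ M_ct 'I_1 (fun=> x) y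
    (fun=> g true) (fun=> f true)) => //.
    by rewrite big_ord1 (gf true).
  by move=> _; apply/X_cotorsion.
- move=> I x s Xx [f [g [_ _ fg]]]; apply/X_cotorsion.
  by apply: (perp_exact_family M_ct n_ge1 fg) => i; apply/X_cotorsion.
- move=> p pM; apply/X_cotorsion; split; first by have [] := pM.
  move=> r d _; rewrite -(prednK n_ge1).
  exact/Ext_exact_projective/(projective_in_projective M_ct).
move=> syz r d [rM rX] x i; case: i => // i Xx _.
elim: i x Xx => [|i IH] x Xx; first by rewrite muln1; apply: rX.
have [k [m [dm [mex mp mk <-]]] Xk] := syz x Xx.
have := IH k Xk; rewrite -mk (mulnS n i.+1) addnC.
(* The positive degree n(i + 1) of the syzygy is written as j + 1, so that [x] gets degree (j + n) +
   1. *)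
rewrite -(prednK (_ : 0 < n * i.+1)%N) ?muln_gt0 ?n_ge1 // addSn.
apply: Ext_exact_n_exact mex _ => j jn.
exact: (projective_in_projective M_ct (mp j jn)).
Qed.
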